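(* Let $q$ be a power of an odd prime and let $(O_t,O_s)$ be a pair of ovals in $PG(2,q)$ such that a Poncelet triangle (a $3$-sided Poncelet polygon) for $(O_t,O_s)$ exists. Then no $m$-sided Poncelet polygon for $(O_t,O_s)$ exists for any $4\le m\le q+1$.
   Context: $PG(2,q)$ is the projective plane over $GF(q)$: points are nonzero vectors $[x,y,z]^T\in GF(q)^3$ up to nonzero scalars, lines are nonzero row vectors $[a,b,c]$ up to nonzero scalars, with incidence $ax+by+cz=0$. An oval in $PG(2,q)$ is a set of $q+1$ points no three of which are collinear. A tangent of an oval $O$ is a line meeting $O$ in exactly one point. For an ordered pair of ovals $(O_t,O_s)$, an $m$-sided Poncelet polygon ($3\le m\le q+1$) is a cyclically ordered $m$-tuple of distinct points of $O_s$ such that each line joining two cyclically consecutive vertices is a tangent of $O_t$. *)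

(* Defs.v *)
From HB Require Import structures.
From mathcomp Require Import all_boot all_order all_algebra.

Set Implicit Arguments.
Unset Strict Implicit.
Unset Printing Implicit Defensive.

Import GRing.Theory.
Local Open Scope ring_scope.

Definition scalar_class (F : finFieldType) (m n : nat) (A : 'M[F]_(m, n)) :
    {set 'M[F]_(m, n)} :=
  [set a *: A | a : F & a != 0].

(* The quotient of the nonzero m x n matrices by nonzero scalars; an element
   of the quotient is represented by the corresponding equivalence class. *)
Record proj (F : finFieldType) (m n : nat) : Type := Proj {
  proj_set :> {set 'M[F]_(m, n)};
  _ : [exists A : 'M[F]_(m, n), (A != 0) && (proj_set == scalar_class A)]
}.

HB.instance Definition _ (F : finFieldType) (m n : nat) :=
  [isSub for @proj_set F m n].
HB.instance Definition _ (F : finFieldType) (m n : nat) :=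
  [Finite of proj F m n by <:].

Notation point F := (proj F 3 1).
Notation line F := (proj F 1 3).

(* Since the condition is homogeneous, quantifying over all representatives
   is the same as using any one representative on each side. *)
Definition incident (F : finFieldType) (P : point F) (L : line F) : bool :=
  [forall v in proj_set P, forall l in proj_set L, l *m v == 0].

Definition collinear (F : finFieldType) (P Q R : point F) : bool :=
  [exists L : line F, [&& incident P L, incident Q L & incident R L]].

Definition oval (F : finFieldType) (O : {set point F}) : Prop :=
  #|O| = #|F|.+1 /\
  forall P Q R : point F, P \in O -> Q \in O -> R \in O ->
    uniq [:: P; Q; R] -> ~~ collinear P Q R.

Definition tangent (F : finFieldType) (O : {set point F}) (L : line F) : bool :=
  #|[set P in O | incident P L]| == 1%N.

(* Only used for P <> Q, where L is then the unique line joining P and Q. *)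
Definition tangent_join (F : finFieldType) (O : {set point F})
    (P Q : point F) : bool :=
  [exists L : line F, [&& incident P L, incident Q L & tangent O L]].

(* The vertices are s_0, ..., s_(m-1); [cycle] also imposes the condition on
   the closing pair (s_(m-1), s_0). *)
Definition poncelet_polygon (F : finFieldType) (Ot Os : {set point F})
    (m : nat) (s : m.-tuple (point F)) : bool :=
  [&& (3 <= m <= #|F|.+1)%N, uniq s, all [in Os] s & cycle (tangent_join Ot) s].

(* Main.v *)
(* A point set satisfying the oval axioms is contained in a conic (Segre): for
   three of its points the tangent functionals t_i satisfy
   t_i(j) t_j(k) t_k(i) = t_i(k) t_j(i) t_k(j) (lemma of tangents), so after
   rescaling t_i(j) = t_j(i), and t_l(l) = 0 for a fourth point l becomes the
   equation of a conic because 2 != 0.  The same identity shows that the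
   tangents of an oval form an oval in the dual plane, so they satisfy the
   equation of a dual conic.

   Take the Poncelet triangle as the triangle of reference.  Then O_s lies in
   a yz + b zx + c xy = 0 and the tangents of O_t lie in
   a' vw + b' wu + c' uv = 0.  Two points P, P' of the first conic are joined
   by a line of the second one if and only if
   B(P, P') = (a'/a) xx' + (b'/b) yy' + (c'/c) zz' = 0, and the B-polar of a
   point of the first conic is itself a line of the second one.  Hence
   B(P_0, P_1) = B(P_1, P_2) = 0 forces B(P_0, P_2) = 0.  In a polygon with at
   least four sides the B-polar of P_0 would then contain the three points
   P_1, P_2, P_{m-1} of O_s, which are not collinear. *)

Require Import Defs.
From mathcomp Require Import all_boot all_order all_algebra.
From mathcomp Require Import all_field ring.

Set Implicit Arguments.
Unset Strict Implicit.
Unset Printing Implicit Defensive.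

Import GRing.Theory.
Local Open Scope ring_scope.

(** * Determinant identities for vectors of dimension three *)

Section Vec3.
Variable F : fieldType.
Notation vec := (F * F * F)%type.
Implicit Types t u v w : vec.

Definition dot3 u v : F := u.1.1 * v.1.1 + u.1.2 * v.1.2 + u.2 * v.2.

Definition cross3 u v : vec :=
  (u.1.2 * v.2 - u.2 * v.1.2, u.2 * v.1.1 - u.1.1 * v.2,
   u.1.1 * v.1.2 - u.1.2 * v.1.1).

Definition det3 u v w : F := dot3 u (cross3 v w).

Lemma det3_rot u v w : det3 v w u = det3 u v w.
Proof. by rewrite /det3 /dot3 /=; ring. Qed.

(** Cramer's rule for [l] in terms of [u], [v], [w], cleared of its denominator, with the functional
    [t] applied to both sides. *)
Lemma det3_cramer t u v w l :
  det3 u v w * dot3 t l =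
  det3 l v w * dot3 t u + det3 u l w * dot3 t v + det3 u v l * dot3 t w.
Proof. by rewrite /det3 /dot3 /=; ring. Qed.

(** Three-term Grassmann-Pluecker relation; it will separate the lines of a pencil through [u]. *)
Lemma det3_plucker u v w l l' :
  det3 u v l * det3 w u l' - det3 u v l' * det3 w u l =
  - (det3 u v w * det3 u l l').
Proof. by rewrite /det3 /dot3 /=; ring. Qed.

Lemma det3M t1 t2 t3 u1 u2 u3 :
  det3 t1 t2 t3 * det3 u1 u2 u3 =
  det3 (dot3 t1 u1, dot3 t1 u2, dot3 t1 u3)
       (dot3 t2 u1, dot3 t2 u2, dot3 t2 u3)
       (dot3 t3 u1, dot3 t3 u2, dot3 t3 u3).
Proof. by rewrite /det3 /dot3 /=; ring. Qed.

(** Otherwise [u], [v], [w] would be a basis, and by Cramer's rule [l] would vanish on every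
    vector. *)
Lemma det3_eq0 u v w l :
  l != 0 -> dot3 l u = 0 -> dot3 l v = 0 -> dot3 l w = 0 -> det3 u v w = 0.
Proof.
move=> l_neq0 lu lv lw; apply/eqP; apply: contraNT l_neq0 => D_neq0.
have lE x : dot3 l x = 0.
  apply: (mulfI D_neq0); rewrite det3_cramer lu lv lw; ring.
apply/eqP; case: l lE {lu lv lw} => [[a b] c] lE.
have := lE (1, 0, 0); have := lE (0, 1, 0); have := lE (0, 0, 1).
by rewrite /dot3 /= !(mulr0, mulr1, addr0, add0r) => -> -> ->.
Qed.

End Vec3.

(** Wilson's theorem: cancel X in X^q - X = prod (X - x) and evaluate at 0. Reindexing by x -> -x
    first absorbs the signs. *)
Lemma prod_unit_finField (F : finFieldType) :
  \prod_(x : F | x != 0) x = -1.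
Proof.
have F_gt1 : (1 < #|F|)%N by apply/card_gt1P; exists 0, 1; rewrite eq_sym oner_neq0.
rewrite (reindex_inj (inv_inj (@opprK F))) /=.
under eq_bigl do rewrite oppr_eq0.
have := finField_genPoly F; rewrite (bigD1 0) //= subr0.
rewrite (_ : 'X^#|F| - 'X = 'X * ('X^(#|F|.-1) - 1)); last first.
  by rewrite mulrBr mulr1 -exprS prednK // ltnW.
move/(mulfI (negbT (polyX_eq0 F))) => /(congr1 (horner^~ 0)).
rewrite hornerD hornerN hornerXn hornerC expr0n -(subnKC F_gt1) /= sub0r => ->.
rewrite horner_prod; apply: eq_bigr => x _.
by rewrite hornerXsubC sub0r.
Qed.

(** * Arcs given by vectors, their tangents, and the lemma of tangents *)

Section Arc.
Variables (F : finFieldType) (T : finType).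
Notation vec := (F * F * F)%type.
Implicit Types (O : {set T}) (v : T -> vec) (i j k l : T) (t : vec).

(** The vectors are indexed by an abstract finite type, so that the points of an oval and its
    tangents can form arcs over the same index set. *)
Definition vec_arc O v : Prop :=
  #|O| = #|F|.+1 /\
  forall i j k, i \in O -> j \in O -> k \in O -> uniq [:: i; j; k] ->
    det3 (v i) (v j) (v k) != 0.

Definition tangent_at O v i t : Prop :=
  forall l, l \in O -> (dot3 t (v l) == 0) = (l == i).

Lemma uniq3E i j k : uniq [:: i; j; k] = [&& i != j, i != k & j != k].
Proof. by rewrite /= !inE negb_or andbT -andbA. Qed.

Section Pencil.
Variables (O : {set T}) (v : T -> vec) (i j k : T).
Hypotheses (arcO : vec_arc O v) (iO : i \in O) (jO : j \in O) (kO : k \in O).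
Hypothesis ijk : uniq [:: i; j; k].

Let S := O :\ i :\ j :\ k.
(** Slope of the line joining [i] to [l]: the parameter m for which det(i,j,-) - m det(k,i,-)
    vanishes at [v l]. The lines ij and ik have slopes 0 and infinity. *)
Let ratio l := det3 (v i) (v j) (v l) / det3 (v k) (v i) (v l).

Let inS l : (l \in S) = [&& l != k, l != j, l != i & l \in O].
Proof. by rewrite !inE. Qed.

Let cardS : #|S|.+2 = #|F|.
Proof.
have [cardO _] := arcO; move: ijk; rewrite uniq3E => /and3P[ij ik jk].
apply: succn_inj; rewrite -cardO (cardsD1 i O) iO (cardsD1 j (O :\ i)).
rewrite (cardsD1 k (O :\ i :\ j)) !inE jO kO /=.
by rewrite [k == j]eq_sym [k == i]eq_sym [j == i]eq_sym ij ik jk.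
Qed.

Let ratio_den l : l \in S -> det3 (v k) (v i) (v l) != 0.
Proof.
move: ijk; rewrite inS uniq3E => /and3P[ij ik jk] /and4P[lk lj li lO].
by apply: arcO.2 => //; rewrite uniq3E ![_ == l]eq_sym lk li eq_sym ik.
Qed.

Let ratio_num l : l \in S -> det3 (v i) (v j) (v l) != 0.
Proof.
move: ijk; rewrite inS uniq3E => /and3P[ij ik jk] /and4P[lk lj li lO].
by apply: arcO.2 => //; rewrite uniq3E ![_ == l]eq_sym ij lj li.
Qed.

Let ratio_inj : {in S &, injective ratio}.
Proof.
move=> l m lS mS /eqP; rewrite eqr_div ?ratio_den // -subr_eq0 det3_plucker.
rewrite oppr_eq0 mulf_eq0 (negPf (arcO.2 _ _ _ iO jO kO ijk)) /=.
apply: contraTeq => lm.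
move: lS mS; rewrite !inS => /and4P[_ _ li lO] /and4P[_ _ mi mO].
by apply: arcO.2 => //; rewrite uniq3E ![i == _]eq_sym li mi.
Qed.

(** The q - 2 slopes of the points of [S], together with 0, leave some [m] of the field free; the
    line of slope [m] through [i] meets the arc nowhere else. *)
Lemma tangent_at_exists : exists t, tangent_at O v i t.
Proof.
have [m m_neq0 mS] : exists2 m, m != 0 & m \notin ratio @: S.
  have : (#|0%R |: ratio @: S| < #|F|)%N.
    rewrite -cardS ltnS (leq_trans (leq_card_setU _ _)) // cards1.
    by rewrite card_in_imset.
  rewrite -(cardsC (0 |: ratio @: S)) -[ltnLHS]addn0 ltn_add2l.
  case/card_gt0P=> m; rewrite !inE negb_or => /andP[m0 mS].
  by exists m.
exists (let: ((a, b), c) := cross3 (v i) (v j) in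
        let: ((a', b'), c') := cross3 (v k) (v i) in
        (a - m * a', b - m * b', c - m * c')) => l lO.
rewrite [X in X == 0](_ : _ =
  det3 (v i) (v j) (v l) - m * det3 (v k) (v i) (v l)); last first.
  by rewrite /det3 /dot3 /=; ring.
have [->|li] := eqVneq l i.
  by apply/eqP; rewrite /det3 /dot3 /=; ring.
move: (ijk); rewrite uniq3E => /and3P[ij ik jk].
have [->|lj] := eqVneq l j.
  rewrite (_ : det3 _ _ _ = 0); last by rewrite /det3 /dot3 /=; ring.
  rewrite sub0r oppr_eq0 mulf_eq0 (negPf m_neq0) /=.
  by apply/negbTE/arcO.2 => //; rewrite uniq3E ij eq_sym ik eq_sym jk.
have [->|lk] := eqVneq l k.
  rewrite (_ : det3 (v k) _ _ = 0); last by rewrite /det3 /dot3 /=; ring.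
  by rewrite mulr0 subr0; apply/negbTE/arcO.2.
have lS : l \in S by rewrite inS lk lj li.
apply: contraNF mS; rewrite subr_eq0 => /eqP lm; apply/imsetP; exists l => //.
by rewrite /ratio lm mulfK // ratio_den.
Qed.

(* The lines of the pencil at [i] joining it to the points other than [j], [k]
   have all nonzero slopes but that of the tangent; this is Wilson's theorem. *)
Lemma prod_pencil t : tangent_at O v i t ->
  (\prod_(l in S) ratio l) * (dot3 t (v j) / dot3 t (v k)) = 1.
Proof.
move=> tan; move: (ijk); rewrite uniq3E => /and3P[ij ik jk].
have ti : dot3 t (v i) = 0 by apply/eqP; rewrite tan.
have tj : dot3 t (v j) != 0 by rewrite tan // eq_sym.
have tk : dot3 t (v k) != 0 by rewrite tan // eq_sym.
(* Slope of the tangent [t]: since [t] vanishes at [v i], Cramer's rule writes it as a combination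
   of det(k,i,-) and det(i,j,-). *)
pose m := - (dot3 t (v j) / dot3 t (v k)).
have m_neq0 : m != 0 by rewrite oppr_eq0 mulf_neq0 ?invr_eq0.
have sub : ratio @: S \subset [set x | (x != 0) && (x != m)].
  apply/subsetP => _ /imsetP[l lS ->]; rewrite inE.
  rewrite mulf_neq0 ?invr_eq0 ?ratio_den ?ratio_num //=.
  have : dot3 t (v l) != 0.
    by move: lS; rewrite inS => /and4P[lk lj li lO]; rewrite tan.
  apply: contraNneq => rm.
  have := det3_cramer t (v i) (v j) (v k) (v l).
  rewrite ti mulr0 add0r (_ : det3 (v i) (v l) _ = det3 (v k) (v i) (v l));
    last by rewrite det3_rot.
  have -> : det3 (v i) (v j) (v l) = m * det3 (v k) (v i) (v l).
    by rewrite -rm /ratio divfK // ratio_den.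
  rewrite (_ : _ + _ = 0); last by rewrite /m; field.
  by move/eqP; rewrite mulf_eq0 (negPf (arcO.2 _ _ _ iO jO kO ijk)).
(* Both sets have q - 2 elements, so the inclusion is an equality. *)
have imE : ratio @: S = [set x | (x != 0) && (x != m)].
  apply/eqP; rewrite eqEcard sub card_in_imset //=.
  rewrite -(leq_add2l 2) !add2n cardS -cardsT.
  rewrite (cardsD1 0 [set: F]) (cardsD1 m ([set: F] :\ 0)) !inE m_neq0 /=.
  rewrite !add1n !ltnS; apply/subset_leq_card/subsetP => x.
  by rewrite !inE andbT andbC.
have := prod_unit_finField F; rewrite (bigD1 m) //=.
have -> : \prod_(x | (x != 0) && (x != m)) x = \prod_(l in S) ratio l.
  rewrite -(big_imset id ratio_inj) imE.
  by apply: eq_bigl => x; rewrite inE.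
by rewrite mulNr => /oppr_inj; rewrite mulrC.
Qed.

End Pencil.

(** Multiply the pencil identities at [i], [j] and [k]: over the common set of remaining points,
    each determinant occurs once above and once below, so only the tangent values survive. *)
Lemma lemma_of_tangents O v i j k ti tj tk : vec_arc O v ->
  i \in O -> j \in O -> k \in O -> uniq [:: i; j; k] ->
  tangent_at O v i ti -> tangent_at O v j tj -> tangent_at O v k tk ->
  dot3 ti (v j) * dot3 tj (v k) * dot3 tk (v i) =
  dot3 ti (v k) * dot3 tj (v i) * dot3 tk (v j).
Proof.
move=> arcO iO jO kO ijk tan_i tan_j tan_k.
have jki : uniq [:: j; k; i] by rewrite -(rot_uniq 2).
have kij : uniq [:: k; i; j] by rewrite -(rot_uniq 1).
have Pi := prod_pencil arcO iO jO kO ijk tan_i.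
have Pj := prod_pencil arcO jO kO iO jki tan_j.
have Pk := prod_pencil arcO kO iO jO kij tan_k.
move: (ijk); rewrite uniq3E => /and3P[ij ik jk].
pose S := O :\ i :\ j :\ k.
have SE1 : O :\ j :\ k :\ i = S.
  by apply/setP => l; rewrite !inE; do !case: eqP => //=.
have SE2 : O :\ k :\ i :\ j = S.
  by apply/setP => l; rewrite !inE; do !case: eqP => //=.
rewrite -/S in Pi; rewrite SE1 in Pj; rewrite SE2 in Pk.
have prod1 :
    \prod_(l in S) (det3 (v i) (v j) (v l) / det3 (v k) (v i) (v l)) *
    \prod_(l in S) (det3 (v j) (v k) (v l) / det3 (v i) (v j) (v l)) *
    \prod_(l in S) (det3 (v k) (v i) (v l) / det3 (v j) (v k) (v l)) = 1.
  rewrite -!big_split big1 //= => l.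
  rewrite !inE => /and4P[lk lj li lO].
  have ? : det3 (v i) (v j) (v l) != 0.
    by apply: arcO.2; rewrite // uniq3E ![_ == l]eq_sym ij li.
  have ? : det3 (v j) (v k) (v l) != 0.
    by apply: arcO.2; rewrite // uniq3E ![_ == l]eq_sym jk lj.
  have ? : det3 (v k) (v i) (v l) != 0.
    by apply: arcO.2; rewrite // uniq3E ![_ == l]eq_sym [k == i]eq_sym ik lk.
  by field; apply/and3P; split.
have ? : dot3 ti (v k) != 0 by rewrite tan_i // eq_sym.
have ? : dot3 tj (v i) != 0 by rewrite tan_j.
have ? : dot3 tk (v j) != 0 by rewrite tan_k.
have : (dot3 ti (v j) / dot3 ti (v k)) * (dot3 tj (v k) / dot3 tj (v i)) *
       (dot3 tk (v i) / dot3 tk (v j)) = 1.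
  rewrite -[LHS]mul1r -{1}prod1 mulrACA (mulrACA (\prod_(l in S) _)).
  by rewrite Pi Pj Pk !mulr1.
move=> E; rewrite -[RHS]mul1r -E; field.
by apply/and3P; split.
Qed.


(** * Uniqueness of tangents, the dual arc, and Segre's theorem with its dual *)

Lemma arc_third O v i : vec_arc O v -> i \in O ->
  exists j k, [/\ j \in O, k \in O & uniq [:: i; j; k]].
Proof.
move=> [cardO _] iO.
have /card_gt1P[j [k [jO kO jk]]] : (1 < #|O :\ i|)%N.
  move: cardO; rewrite (cardsD1 i) iO add1n => /succn_inj ->.
  by apply/card_gt1P; exists 0, 1; rewrite eq_sym oner_neq0.
move: jO kO; rewrite !inE => /andP[ji jO] /andP[ki kO].
by exists j, k; rewrite uniq3E ![i == _]eq_sym ji ki.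
Qed.

Lemma tangent_at_neq0 O v i t : vec_arc O v -> i \in O -> tangent_at O v i t ->
  t != 0.
Proof.
move=> arcO iO tan; have [j [k [jO _]]] := arc_third arcO iO.
rewrite uniq3E => /and3P[ij _ _]; apply: contraNneq ij => t0.
by rewrite eq_sym -tan // t0 /dot3 /= !mul0r !addr0.
Qed.

(** With tangents at two further points [j], [k] fixed, the lemma of tangents determines the ratio
    of the values at [v j] and [v k]; the value at [v i] is 0, so Cramer's rule gives
    proportionality. *)
Lemma tangent_at_unique O v i t t' : vec_arc O v -> i \in O ->
  tangent_at O v i t -> tangent_at O v i t' ->
  exists2 c, c != 0 & forall u, dot3 t' u = c * dot3 t u.
Proof.
move=> arcO iO tan tan'; have [j [k [jO kO ijk]]] := arc_third arcO iO.
move: (ijk); rewrite uniq3E => /and3P[ij ik jk].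
have jik : uniq [:: j; i; k] by rewrite uniq3E eq_sym ij ik jk.
have kij : uniq [:: k; i; j] by rewrite -(rot_uniq 1).
have [tj tanj] := tangent_at_exists arcO jO iO kO jik.
have [tk tank] := tangent_at_exists arcO kO iO jO kij.
have E := lemma_of_tangents arcO iO jO kO ijk tan tanj tank.
have E' := lemma_of_tangents arcO iO jO kO ijk tan' tanj tank.
have ti : dot3 t (v i) = 0 by apply/eqP; rewrite tan.
have t'i : dot3 t' (v i) = 0 by apply/eqP; rewrite tan'.
have t_k : dot3 t (v k) != 0 by rewrite tan // eq_sym.
have t'_k : dot3 t' (v k) != 0 by rewrite tan' // eq_sym.
have tjk : dot3 tj (v k) != 0 by rewrite tanj // eq_sym.
have tki : dot3 tk (v i) != 0 by rewrite tank.
have EE : dot3 t' (v j) * dot3 t (v k) = dot3 t' (v k) * dot3 t (v j).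
  apply: (mulfI (mulf_neq0 tjk tki)).
  transitivity (dot3 t (v k) *
    (dot3 t' (v j) * dot3 tj (v k) * dot3 tk (v i))); first by ring.
  rewrite E'; transitivity (dot3 t' (v k) *
    (dot3 t (v j) * dot3 tj (v k) * dot3 tk (v i))); last by ring.
  by rewrite E; ring.
exists (dot3 t' (v k) / dot3 t (v k)); first by rewrite mulf_neq0 ?invr_eq0.
move=> u; apply: (mulfI (mulf_neq0 (arcO.2 _ _ _ iO jO kO ijk) t_k)).
transitivity (dot3 t (v k) * (det3 (v i) (v j) (v k) * dot3 t' u)).
  by ring.
transitivity (dot3 t' (v k) * (det3 (v i) (v j) (v k) * dot3 t u)); last first.
  by field.
rewrite (det3_cramer t') (det3_cramer t (v i)) ti t'i !mulr0 !add0r.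
transitivity (det3 (v i) u (v k) * (dot3 t' (v j) * dot3 t (v k)) +
  det3 (v i) (v j) u * (dot3 t' (v k) * dot3 t (v k))); first by ring.
by rewrite EE; ring.
Qed.

(** The matrix of the values of the three tangents at the three points has zero diagonal, so its
    determinant is a sum of two cyclic products. These agree by the lemma of tangents, and twice a
    nonzero product is nonzero. *)
Lemma tangent_arc O v (t : T -> vec) : (2%:R : F) != 0 -> vec_arc O v ->
  (forall i, i \in O -> tangent_at O v i (t i)) -> vec_arc O t.
Proof.
move=> two_neq0 arcO tan; split=> [|i j k iO jO kO ijk]; first exact: arcO.1.
have E := lemma_of_tangents arcO iO jO kO ijk (tan i iO) (tan j jO) (tan k kO).
have tii l : l \in O -> dot3 (t l) (v l) = 0.
  by move=> lO; apply/eqP; rewrite tan.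
suff: det3 (t i) (t j) (t k) * det3 (v i) (v j) (v k) != 0.
  by rewrite mulf_eq0 negb_or => /andP[].
rewrite det3M !tii // [X in X != 0](_ : _ =
  dot3 (t i) (v j) * dot3 (t j) (v k) * dot3 (t k) (v i) +
  dot3 (t i) (v k) * dot3 (t j) (v i) * dot3 (t k) (v j)); last first.
  by rewrite {1}/det3 {1}/dot3 /=; ring.
move: ijk; rewrite uniq3E => /and3P[ij ik jk].
rewrite -E -mulr2n -mulr_natl !mulf_neq0 //.
- by rewrite tan // eq_sym.
- by rewrite tan // eq_sym.
- by rewrite tan.
Qed.

Theorem segre O v i j k : (2%:R : F) != 0 -> vec_arc O v ->
  i \in O -> j \in O -> k \in O -> uniq [:: i; j; k] ->
  exists a b c, [/\ a != 0, b != 0, c != 0 &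
    forall l, l \in O ->
      let x := det3 (v l) (v j) (v k) in
      let y := det3 (v i) (v l) (v k) in
      let z := det3 (v i) (v j) (v l) in
      a * (y * z) + b * (z * x) + c * (x * y) = 0].
Proof.
move=> two_neq0 arcO iO jO kO ijk.
move: (ijk); rewrite uniq3E => /and3P[ij ik jk].
have jik : uniq [:: j; i; k] by rewrite uniq3E eq_sym ij ik jk.
have kij : uniq [:: k; i; j] by rewrite -(rot_uniq 1).
have [ti tani] := tangent_at_exists arcO iO jO kO ijk.
have [tj tanj] := tangent_at_exists arcO jO iO kO jik.
have [tk tank] := tangent_at_exists arcO kO iO jO kij.
have E := lemma_of_tangents arcO iO jO kO ijk tani tanj tank.
have tii : dot3 ti (v i) = 0 by apply/eqP; rewrite tani.
have tjj : dot3 tj (v j) = 0 by apply/eqP; rewrite tanj.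
have tkk : dot3 tk (v k) = 0 by apply/eqP; rewrite tank.
have tij : dot3 ti (v j) != 0 by rewrite tani // eq_sym.
have tik : dot3 ti (v k) != 0 by rewrite tani // eq_sym.
have tji : dot3 tj (v i) != 0 by rewrite tanj.
have tjk : dot3 tj (v k) != 0 by rewrite tanj // eq_sym.
have tki : dot3 tk (v i) != 0 by rewrite tank.
have tkj : dot3 tk (v j) != 0 by rewrite tank.
(* Rescale [tj] and [tk] to agree with [ti] in the sense ti(j) = tj(i) and ti(k) = tk(i). The
   coefficients are then tj(k), tk(i) and ti(j). *)
exists (dot3 ti (v j) * dot3 tj (v k) / dot3 tj (v i)).
exists (dot3 ti (v k)), (dot3 ti (v j)).
split=> //; first by rewrite !mulf_neq0 ?invr_eq0.
move=> l lO.
(* At a vertex of the reference triangle two of the coordinates vanish. *)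
have [->|li] := eqVneq l i; first by rewrite /det3 /dot3 /=; ring.
have [->|lj] := eqVneq l j; first by rewrite /det3 /dot3 /=; ring.
have [->|lk] := eqVneq l k; first by rewrite /det3 /dot3 /=; ring.
move=> x y z.
have ijl : uniq [:: i; j; l] by rewrite uniq3E ![_ == l]eq_sym ij li lj.
have ikl : uniq [:: i; k; l] by rewrite uniq3E ![_ == l]eq_sym ik li lk.
have lij : uniq [:: l; i; j] by rewrite uniq3E ij li lj.
have [t tanl] := tangent_at_exists arcO lO iO jO lij.
have Ej := lemma_of_tangents arcO iO jO lO ijl tani tanj tanl.
have Ek := lemma_of_tangents arcO iO kO lO ikl tani tank tanl.
have tl : dot3 t (v l) = 0 by apply/eqP; rewrite tanl.
have t_i : dot3 t (v i) != 0 by rewrite tanl // eq_sym.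
have til : dot3 ti (v l) != 0 by rewrite tani.
have D_neq0 := arcO.2 _ _ _ iO jO kO ijk.
set D := det3 _ _ _ in D_neq0.
have C := det3_cramer t (v i) (v j) (v k) (v l).
have Ci := det3_cramer ti (v i) (v j) (v k) (v l).
have Cj := det3_cramer tj (v i) (v j) (v k) (v l).
have Ck := det3_cramer tk (v i) (v j) (v k) (v l).
rewrite -/D -/x -/y -/z tl mulr0 in C.
rewrite -/D -/x -/y -/z tii mulr0 add0r in Ci.
rewrite -/D -/x -/y -/z tjj mulr0 addr0 in Cj.
rewrite -/D -/x -/y -/z tkk mulr0 addr0 in Ck.
move: E Ej Ek C Ci Cj Ck tij tik tji tjk tki tkj t_i til two_neq0.
move: (dot3 ti (v j)) (dot3 ti (v k)) (dot3 tj (v i)) (dot3 tj (v k))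
  (dot3 tk (v i)) (dot3 tk (v j)) (dot3 t (v i)) (dot3 t (v j)) (dot3 t (v k))
  (dot3 ti (v l)) (dot3 tj (v l)) (dot3 tk (v l)).
move: x y z D D_neq0 => x y z D D0 t12 t13 t21 t23 t31 t32 s1 s2 s3 r1 r2 r3.
move=> E Ej Ek C Ci Cj Ck n12 n13 n21 n23 n31 n32 ns1 nr1 two0.
have {}Ej : s2 = t12 * r2 * s1 / (r1 * t21).
  by rewrite Ej; field; apply/andP.
have {}Ek : s3 = t13 * r3 * s1 / (r1 * t31).
  by rewrite Ek; field; apply/andP.
(* The equation t(l) = 0 multiplied by [D], with [t] scaled so that its values at i, j, k are those
   of the rescaled [ti], [tj], [tk] at [l]. *)
have C' : D * (r1 * x) + y * t12 * (D * r2) / t21 + z * t13 * (D * r3) / t31 = 0.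
  transitivity (D * r1 / s1 * (x * s1 + y * s2 + z * s3)).
    by rewrite Ej Ek; field; do ?[apply/andP; split].
  by rewrite -C mulr0.
have {}E : t23 = t13 * t21 * t32 / (t12 * t31).
  by rewrite -E; field; apply/andP.
(* Expanding each tangent value at [l] by Cramer's rule produces every mixed product twice, hence
   twice the conic. *)
apply: (mulfI two0); rewrite mulr0 -[RHS]C' [D * (r1 * x)]mulrA Ci Cj Ck E.
by field; do ?[apply/andP; split].
Qed.

(** Segre's theorem applied to the dual arc. The sides BC, CA, AB of the triangle are the tangents
    [ti], [tj], [tk], and a tangent has its values at A, B, C as coordinates. *)
Lemma dual_segre O v i j k (ti tj tk A B C : vec) :
  (2%:R : F) != 0 -> vec_arc O v -> i \in O -> j \in O -> k \in O ->
  tangent_at O v i ti -> tangent_at O v j tj -> tangent_at O v k tk ->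
  det3 A B C != 0 ->
  dot3 ti B = 0 -> dot3 ti C = 0 -> dot3 tj C = 0 -> dot3 tj A = 0 ->
  dot3 tk A = 0 -> dot3 tk B = 0 ->
  exists a b c, [/\ a != 0, b != 0, c != 0 &
    forall l t, l \in O -> tangent_at O v l t ->
      a * (dot3 t B * dot3 t C) + b * (dot3 t C * dot3 t A) +
      c * (dot3 t A * dot3 t B) = 0].
Proof.
move=> two_neq0 arcO iO jO kO tani tanj tank D_neq0 tiB tiC tjC tjA tkA tkB.
have tan_neq0 := tangent_at_neq0 arcO.
have tiA : dot3 ti A != 0.
  by apply: contraNneq D_neq0 => tiA; apply/eqP/(det3_eq0 (tan_neq0 _ _ iO tani)).
have tjB : dot3 tj B != 0.
  by apply: contraNneq D_neq0 => tjB; apply/eqP/(det3_eq0 (tan_neq0 _ _ jO tanj)).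
have tkC : dot3 tk C != 0.
  by apply: contraNneq D_neq0 => tkC; apply/eqP/(det3_eq0 (tan_neq0 _ _ kO tank)).
have ex_t l : exists t, l \in O -> tangent_at O v l t.
  (* The value 0 outside [O] is an arbitrary default, making the choice of tangents total. *)
  case lO: (l \in O); last by exists 0.
  have [m [n [mO nO lmn]]] := arc_third arcO lO.
  by have [t] := tangent_at_exists arcO lO mO nO lmn; exists t.
have [t tan] := fin_all_exists ex_t.
(* If two contact points coincided, their tangents would be proportional, and one of them would
   vanish at A, B and C. *)
have ijk : uniq [:: i; j; k].
  rewrite uniq3E; apply/and3P; split.
  - apply: contraNneq tiA => ij; rewrite -ij in tanj.
    have [c _ ->] := tangent_at_unique arcO iO tanj tani.
    by rewrite tjA mulr0.
  - apply: contraNneq tiA => ik; rewrite -ik in tank.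
    have [c _ ->] := tangent_at_unique arcO iO tank tani.
    by rewrite tkA mulr0.
  - apply: contraNneq tjB => jk; rewrite -jk in tank.
    have [c _ ->] := tangent_at_unique arcO jO tank tanj.
    by rewrite tkB mulr0.
have [a [b [c [a0 b0 c0 abc]]]] :=
  segre two_neq0 (tangent_arc two_neq0 arcO tan) iO jO kO ijk.
have [ci ci0 tiE] := tangent_at_unique arcO iO tani (tan i iO).
have [cj cj0 tjE] := tangent_at_unique arcO jO tanj (tan j jO).
have [ck ck0 tkE] := tangent_at_unique arcO kO tank (tan k kO).
(* Passing from determinants of tangents to values at A, B, C scales each coordinate by two of the
   three values t_i(A), t_j(B), t_k(C). Cancelling the product of all three leaves one in each
   coefficient. *)
exists (a * (ci * dot3 ti A)), (b * (cj * dot3 tj B)), (c * (ck * dot3 tk C)).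
split; rewrite ?mulf_neq0 // => l s lO tans.
have [cl cl0 sE] := tangent_at_unique arcO lO (tan l lO) tans.
have xE : det3 (t l) (t j) (t k) * det3 A B C =
    dot3 (t l) A * (cj * dot3 tj B) * (ck * dot3 tk C).
  by rewrite det3M !tjE !tkE tjA tjC tkA tkB {1}/det3 {1}/dot3 /=; ring.
have yE : det3 (t i) (t l) (t k) * det3 A B C =
    (ci * dot3 ti A) * dot3 (t l) B * (ck * dot3 tk C).
  by rewrite det3M !tiE !tkE tiB tiC tkA tkB {1}/det3 {1}/dot3 /=; ring.
have zE : det3 (t i) (t j) (t l) * det3 A B C =
    (ci * dot3 ti A) * (cj * dot3 tj B) * dot3 (t l) C.
  by rewrite det3M !tiE !tjE tiB tiC tjA tjC {1}/det3 {1}/dot3 /=; ring.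
have n0 : (ci * dot3 ti A) * (cj * dot3 tj B) * (ck * dot3 tk C) != 0.
  by rewrite !mulf_neq0.
apply: (mulfI n0); rewrite mulr0 !sE.
have := congr1 ( *%R (cl ^+ 2 * det3 A B C ^+ 2)) (abc l lO); rewrite mulr0.
move=> <-; symmetry.
move: xE yE zE; set D := det3 A B C.
set x := det3 (t l) _ _; set y := det3 _ (t l) _; set z := det3 _ _ (t l).
move=> xE yE zE.
transitivity (cl ^+ 2 *
  (a * ((y * D) * (z * D)) + b * ((z * D) * (x * D)) + c * ((x * D) * (y * D)))).
  by ring.
by rewrite xE yE zE; ring.
Qed.

End Arc.

(** * A conic through the vertices of the reference triangle and a dual conic containing its
    sides *)

Section Poncelet.
Variable F : fieldType.
Notation vec := (F * F * F)%type.
Implicit Types (X Y l n : vec).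
Variables a b c a' b' c' : F.
Hypotheses (a_neq0 : a != 0) (b_neq0 : b != 0) (c_neq0 : c != 0).

Definition conic X :=
  a * (X.1.2 * X.2) + b * (X.2 * X.1.1) + c * (X.1.1 * X.1.2).

Definition dual_conic l :=
  a' * (l.1.2 * l.2) + b' * (l.2 * l.1.1) + c' * (l.1.1 * l.1.2).

Definition conic_pol X Y :=
  a * (X.1.2 * Y.2 + X.2 * Y.1.2) + b * (X.2 * Y.1.1 + X.1.1 * Y.2) +
  c * (X.1.1 * Y.1.2 + X.1.2 * Y.1.1).

(* The functional [B(X, -)], cleared of the denominators [a], [b], [c]. *)
Definition triangle_polar X : vec :=
  (a' * b * c * X.1.1, a * b' * c * X.1.2, a * b * c' * X.2).

(** Each difference of the two sides is a combination of the two conic equations. Thus the products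
    of line coordinates in the dual conic become xx'/a, yy'/b, zz'/c up to one common factor. *)
Lemma conic_cross X Y : conic X = 0 -> conic Y = 0 ->
  [/\ a * ((cross3 X Y).1.2 * (cross3 X Y).2) =
        X.1.1 * Y.1.1 * conic_pol X Y,
      b * ((cross3 X Y).2 * (cross3 X Y).1.1) =
        X.1.2 * Y.1.2 * conic_pol X Y &
      c * ((cross3 X Y).1.1 * (cross3 X Y).1.2) =
        X.2 * Y.2 * conic_pol X Y].
Proof.
case: X Y => [[x y] z] [[x' y'] z']; rewrite /conic /conic_pol /= => SX SY.
split; apply/eqP; rewrite -subr_eq0.
- rewrite (_ : _ - _ =
    - (x' ^+ 2 * (a * (y * z) + b * (z * x) + c * (x * y)) +
       x ^+ 2 * (a * (y' * z') + b * (z' * x') + c * (x' * y')))); last by ring.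
  by rewrite SX SY !mulr0 addr0 oppr0.
- rewrite (_ : _ - _ =
    - (y' ^+ 2 * (a * (y * z) + b * (z * x) + c * (x * y)) +
       y ^+ 2 * (a * (y' * z') + b * (z' * x') + c * (x' * y')))); last by ring.
  by rewrite SX SY !mulr0 addr0 oppr0.
- rewrite (_ : _ - _ =
    - (z' ^+ 2 * (a * (y * z) + b * (z * x) + c * (x * y)) +
       z ^+ 2 * (a * (y' * z') + b * (z' * x') + c * (x' * y')))); last by ring.
  by rewrite SX SY !mulr0 addr0 oppr0.
Qed.

(** Otherwise the whole line XY would lie on the conic, which is nondegenerate because [a], [b], [c]
    are nonzero. *)
Lemma conic_pol_neq0 X Y : conic X = 0 -> conic Y = 0 ->
  cross3 X Y != 0 -> conic_pol X Y != 0.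
Proof.
move=> SX SY; have [E1 E2 E3] := conic_cross SX SY; apply: contraNneq => S0.
(* The discriminant of the binary form obtained by restricting the conic to
   the line XY, computed in two ways. *)
have : a ^+ 2 * (cross3 X Y).1.1 ^+ 2 + b ^+ 2 * (cross3 X Y).1.2 ^+ 2 +
       c ^+ 2 * (cross3 X Y).2 ^+ 2 =
       conic_pol X Y ^+ 2 - 4%:R * conic X * conic Y +
       2%:R * (b * c * ((cross3 X Y).1.2 * (cross3 X Y).2) +
               c * a * ((cross3 X Y).2 * (cross3 X Y).1.1) +
               a * b * ((cross3 X Y).1.1 * (cross3 X Y).1.2)).
  by rewrite /conic /conic_pol /=; ring.
rewrite S0 !mulr0 in E1 E2 E3; rewrite S0 SX mulr0 mul0r subr0 expr0n add0r.
case: (cross3 X Y) E1 E2 E3 => [[u v] w] /=.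
move=> E1 E2 E3.
have wu : w * u = 0 by apply: (mulfI b_neq0); rewrite E2 mulr0.
have uv : u * v = 0 by apply: (mulfI c_neq0); rewrite E3 mulr0.
have vw : v * w = 0 by apply: (mulfI a_neq0); rewrite E1 mulr0.
rewrite wu uv vw !mulr0 !addr0 mulr0 => Q.
have sq0 (d e : F) : d != 0 -> (d * e ^+ 2) ^+ 2 = 0 -> e = 0.
  move=> d0 /eqP; rewrite expf_eq0 mulf_eq0 expf_eq0 /= (negPf d0).
  by move/eqP.
apply/eqP; congr (_, _, _).
(* Pairwise products of u, v, w vanish, so multiplying [Q] by the square of one coordinate isolates
   its fourth power. *)
- apply: (sq0 a) => //; transitivity (u ^+ 2 *
    (a ^+ 2 * u ^+ 2 + b ^+ 2 * v ^+ 2 + c ^+ 2 * w ^+ 2) -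
    b ^+ 2 * (u * v) ^+ 2 - c ^+ 2 * (w * u) ^+ 2); first by ring.
  by rewrite Q uv wu expr0n !mulr0 !subr0.
- apply: (sq0 b) => //; transitivity (v ^+ 2 *
    (a ^+ 2 * u ^+ 2 + b ^+ 2 * v ^+ 2 + c ^+ 2 * w ^+ 2) -
    a ^+ 2 * (u * v) ^+ 2 - c ^+ 2 * (v * w) ^+ 2); first by ring.
  by rewrite Q uv vw expr0n !mulr0 !subr0.
- apply: (sq0 c) => //; transitivity (w ^+ 2 *
    (a ^+ 2 * u ^+ 2 + b ^+ 2 * v ^+ 2 + c ^+ 2 * w ^+ 2) -
    a ^+ 2 * (w * u) ^+ 2 - b ^+ 2 * (v * w) ^+ 2); first by ring.
  by rewrite Q wu vw expr0n !mulr0 !subr0.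
Qed.

(** Both [l] and the cross product annihilate [X] and [Y], so the latter is a multiple of [l];
    homogeneity is used in cross-multiplied form to avoid division. *)
Lemma dual_conic_cross l X Y : l != 0 -> dual_conic l = 0 ->
  dot3 l X = 0 -> dot3 l Y = 0 -> dual_conic (cross3 X Y) = 0.
Proof.
move=> l0 Tl lX lY.
have par : cross3 l (cross3 X Y) = 0.
  move: lX lY; rewrite /cross3 /dot3 /= => lX lY.
  congr (_, _, _).
  - transitivity (X.1.1 * (l.1.1 * Y.1.1 + l.1.2 * Y.1.2 + l.2 * Y.2) -
      Y.1.1 * (l.1.1 * X.1.1 + l.1.2 * X.1.2 + l.2 * X.2)); first by ring.
    by rewrite lX lY !mulr0 subr0.
  - transitivity (X.1.2 * (l.1.1 * Y.1.1 + l.1.2 * Y.1.2 + l.2 * Y.2) -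
      Y.1.2 * (l.1.1 * X.1.1 + l.1.2 * X.1.2 + l.2 * X.2)); first by ring.
    by rewrite lX lY !mulr0 subr0.
  - transitivity (X.2 * (l.1.1 * Y.1.1 + l.1.2 * Y.1.2 + l.2 * Y.2) -
      Y.2 * (l.1.1 * X.1.1 + l.1.2 * X.1.2 + l.2 * X.2)); first by ring.
    by rewrite lX lY !mulr0 subr0.
case: (cross3 X Y) par => [[p q] r]; case: l l0 Tl {lX lY} => [[u v] w] l0 Tl.
rewrite /cross3 /= => -[/subr0_eq E1 /subr0_eq E2 /subr0_eq E3].
move: Tl; rewrite /dual_conic /= => Tl.
apply/eqP; apply: contraNT l0 => T0.
have sq0 (d : F) : d ^+ 2 * (a' * (q * r) + b' * (r * p) + c' * (p * q)) = 0 ->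
    d = 0.
  by move/eqP; rewrite mulf_eq0 (negPf T0) orbF expf_eq0 => /eqP.
apply/eqP; congr (_, _, _); apply: sq0.
- transitivity (a' * ((u * q) * (u * r)) + b' * u * ((u * r) * p) +
    c' * u * p * (u * q)); first by ring.
  rewrite E3 -E2; transitivity (p ^+ 2 * (a' * (v * w) + b' * (w * u) + c' * (u * v))).
    by ring.
  by rewrite Tl mulr0.
- transitivity (a' * (v * q) * (v * r) + b' * ((v * r) * (v * p)) +
    c' * v * q * (v * p)); first by ring.
  rewrite -E3 E1; transitivity (q ^+ 2 * (a' * (v * w) + b' * (w * u) + c' * (u * v))).
    by ring.
  by rewrite Tl mulr0.
- transitivity (a' * (w * q) * w * r + b' * (w * r * (w * p)) +
    c' * (w * p) * (w * q)); first by ring.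
  rewrite E2 -E1; transitivity (r ^+ 2 * (a' * (v * w) + b' * (w * u) + c' * (u * v))).
    by ring.
  by rewrite Tl mulr0.
Qed.

(** On the line XY the dual conic equals, up to the factor abc, the form B(X, Y) times
    [conic_pol X Y], and the latter can be cancelled. *)
Lemma dual_conic_conjugate l X Y : conic X = 0 -> conic Y = 0 ->
  cross3 X Y != 0 -> l != 0 -> dual_conic l = 0 ->
  dot3 l X = 0 -> dot3 l Y = 0 -> dot3 (triangle_polar X) Y = 0.
Proof.
move=> SX SY XY l0 Tl lX lY.
have [E1 E2 E3] := conic_cross SX SY.
apply: (mulIf (conic_pol_neq0 SX SY XY)); rewrite mul0r.
transitivity (a' * b * c * (X.1.1 * Y.1.1 * conic_pol X Y) +
  a * b' * c * (X.1.2 * Y.1.2 * conic_pol X Y) +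
  a * b * c' * (X.2 * Y.2 * conic_pol X Y)); first by rewrite /dot3 /=; ring.
rewrite -E1 -E2 -E3.
transitivity (a * b * c * dual_conic (cross3 X Y)).
  by rewrite /dual_conic; ring.
by rewrite (dual_conic_cross l0) // mulr0.
Qed.

Lemma dual_conic_triangle_polar X : conic X = 0 ->
  dual_conic (triangle_polar X) = 0.
Proof.
move=> SX; transitivity (a * b * c * a' * b' * c' * conic X).
  by rewrite /conic /dual_conic /=; ring.
by rewrite SX mulr0.
Qed.

End Poncelet.

(** * From projective points and lines to vectors *)

Section Projective.
Variable F : finFieldType.
Notation vec := (F * F * F)%type.

Let i1 : 'I_3 := lift ord0 ord0.
Let i2 : 'I_3 := lift ord0 (lift ord0 ord0).

Definition vec_of_row (l : 'rV[F]_3) : vec := (l 0 ord0, l 0 i1, l 0 i2).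

Lemma mul_row_vec (l : 'rV[F]_3) (A : 'cV[F]_3) :
  (l *m A == 0) = (dot3 (vec_of_row l) (vec_of_row A^T) == 0).
Proof.
have -> : (l *m A == 0) = ((l *m A) 0 0 == 0).
  apply/eqP/eqP => [->|lA]; first by rewrite mxE.
  by apply/matrixP => m n; rewrite !ord1 lA mxE.
rewrite mxE !big_ord_recl big_ord0 addr0 /dot3 /=.
by rewrite !mxE addrA.
Qed.

Definition rep m n (P : proj F m n) : 'M[F]_(m, n) := xchoose (existsP (valP P)).

Lemma rep_neq0 m n (P : proj F m n) : rep P != 0.
Proof. by have /andP[] := xchooseP (existsP (valP P)). Qed.

Lemma repE m n (P : proj F m n) : proj_set P = scalar_class (rep P).
Proof. by have /andP[_ /eqP] := xchooseP (existsP (valP P)). Qed.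

Lemma rep_mem m n (P : proj F m n) : rep P \in proj_set P.
Proof.
by rewrite repE; apply/imsetP; exists 1; rewrite ?scale1r // inE oner_neq0.
Qed.

Definition point_vec (P : point F) : vec := vec_of_row (rep P)^T.
Definition line_vec (L : line F) : vec := vec_of_row (rep L).

Lemma incidentE (P : point F) (L : line F) :
  incident P L = (dot3 (line_vec L) (point_vec P) == 0).
Proof.
rewrite -mul_row_vec; apply/idP/idP => [/forall_inP/(_ _ (rep_mem P))|/eqP LP].
  by move/forall_inP/(_ _ (rep_mem L)).
apply/forall_inP => v; rewrite repE => /imsetP[x _ ->].
apply/forall_inP => l; rewrite repE => /imsetP[y _ ->].
by rewrite -scalemxAl -scalemxAr LP !scaler0.
Qed.

Lemma line_of_row (l : 'rV[F]_3) : l != 0 ->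
  exists L : line F, forall P, (l *m rep P == 0) -> incident P L.
Proof.
move=> l0; have lP : [exists A, (A != 0) && (scalar_class l == scalar_class A)].
  by apply/existsP; exists l; rewrite l0 eqxx.
exists (Proj lP) => P /eqP lP0.
apply/forall_inP => v; rewrite repE => /imsetP[x _ ->].
apply/forall_inP => _ /imsetP[y _ ->].
by rewrite -scalemxAl -scalemxAr lP0 !scaler0.
Qed.

(** The matrix with the three representatives as columns is singular; a nonzero row in its left
    kernel is a line through the three points. *)
Lemma collinear_det0 (P Q R : point F) :
  det3 (point_vec P) (point_vec Q) (point_vec R) = 0 -> collinear P Q R.
Proof.
pose c (j : nat) := if j is 0 then rep P else if j is 1 then rep Q else rep R.
pose M : 'M[F]_3 := \matrix_(i, j) c j i 0.
have ->: det3 (point_vec P) (point_vec Q) (point_vec R) = \det M.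
  rewrite (expand_det_row _ ord0) !big_ord_recl big_ord0 /cofactor.
  rewrite !(@expand_det_row _ 2 _ ord0) !big_ord_recl !big_ord0 /cofactor !det_mx11.
  rewrite !mxE /= /det3 /dot3 /point_vec /vec_of_row /= !mxE.
  rewrite -/i1 (_ : lift ord0 (lift ord0 0) = i2); last exact: val_inj.
  by rewrite /bump /=; ring.
move/eqP/det0P => [l l0 lM].
have [L LP] := line_of_row l0; apply/existsP; exists L.
have lj (j : 'I_3) : l *m c j == 0.
  apply/eqP/matrixP => m n; rewrite !ord1 [RHS]mxE -[RHS](_ : (l *m M) 0 j = 0).
    by rewrite !mxE; apply: eq_bigr => k _; rewrite mxE.
  by rewrite lM mxE.
by rewrite !LP // ?(lj ord0) ?(lj i1) ?(lj i2).
Qed.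

Lemma oval_arc (O : {set point F}) : oval O -> vec_arc O point_vec.
Proof.
move=> [cardO ncol]; split=> // P Q R PO QO RO PQR.
by apply: contra (ncol P Q R PO QO RO PQR) => /eqP; apply: collinear_det0.
Qed.

End Projective.

(** * Change of coordinates to the Poncelet triangle and the closing argument *)

Section Joined.
Variables (F : finFieldType) (T : finType).
Notation vec := (F * F * F)%type.
Implicit Types (O : {set T}) (v : T -> vec) (t u A B C : vec).

(* Coordinates of [u] in the basis [A], [B], [C], multiplied by [det3 A B C]. *)
Definition coords A B C u : vec := (det3 u B C, det3 A u C, det3 A B u).

(** The coordinate map is given by the cofactor matrix of A, B, C, whose determinant is the square
    of theirs. *)
Lemma det3_coords A B C u1 u2 u3 :
  det3 (coords A B C u1) (coords A B C u2) (coords A B C u3) =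
  det3 A B C ^+ 2 * det3 u1 u2 u3.
Proof.
have -> : det3 A B C ^+ 2 = det3 (cross3 B C) (cross3 C A) (cross3 A B).
  by rewrite /det3 /dot3 /=; ring.
by rewrite det3M /coords /det3 /dot3 /=; ring.
Qed.

Lemma dot3_coords A B C t u :
  dot3 (dot3 t A, dot3 t B, dot3 t C) (coords A B C u) =
  det3 A B C * dot3 t u.
Proof. by rewrite det3_cramer /coords {1}/dot3 /=; ring. Qed.

Definition tangent_joined O v (i j : T) : Prop :=
  exists k t, [/\ k \in O, tangent_at O v k t, dot3 t (v i) = 0 &
    dot3 t (v j) = 0].

Lemma poncelet_triangle_unique (Ot Os : {set T}) v (i j k p0 p1 p2 p3 : T) :
  (2%:R : F) != 0 -> vec_arc Ot v -> vec_arc Os v ->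
  i \in Os -> j \in Os -> k \in Os -> uniq [:: i; j; k] ->
  tangent_joined Ot v i j -> tangent_joined Ot v j k ->
  tangent_joined Ot v k i ->
  p0 \in Os -> p1 \in Os -> p2 \in Os -> p3 \in Os ->
  uniq [:: p0; p1; p2; p3] ->
  tangent_joined Ot v p0 p1 -> tangent_joined Ot v p1 p2 ->
  ~ tangent_joined Ot v p3 p0.
Proof.
move=> two_neq0 arcT arcS iO jO kO ijk.
(* The tangents [ta], [tb], [tc] are the sides opposite to [v i], [v j], [v k], with contact points
   [a0], [b0], [c0]. *)
move=> [c0 [tc [c0O tanc tci tcj]]] [a0 [ta [a0O tana taj tak]]].
move=> [b0 [tb [b0O tanb tbk tbi]]] p0O p1O p2O p3O p_uniq j01 j12 j30.
have D_neq0 := arcS.2 _ _ _ iO jO kO ijk.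
have [a [b [c [a_n0 b_n0 c_n0 Sabc]]]] := segre two_neq0 arcS iO jO kO ijk.
have [a' [b' [c' [a'_n0 b'_n0 c'_n0 Tabc]]]] := dual_segre two_neq0 arcT
  a0O b0O c0O tana tanb tanc D_neq0 taj tak tbk tbi tci tcj.
pose X l := coords (v i) (v j) (v k) (v l).
have SX l : l \in Os -> conic a b c (X l) = 0 by move/Sabc.
have X_det l m n : l \in Os -> m \in Os -> n \in Os -> uniq [:: l; m; n] ->
    det3 (X l) (X m) (X n) != 0.
  move=> lO mO nO lmn; rewrite det3_coords mulf_neq0 ?expf_neq0 //.
  exact: arcS.2.
have X_cross l m n : l \in Os -> m \in Os -> n \in Os -> uniq [:: l; m; n] ->
    cross3 (X m) (X n) != 0.
  move=> lO mO nO /(X_det _ _ _ lO mO nO); apply: contraNneq => X0.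
  by rewrite /det3 X0 /dot3 /= !mulr0 !addr0.
pose pol l := triangle_polar a b c a' b' c' (X l).
have polC l m : dot3 (pol l) (X m) = dot3 (pol m) (X l).
  by rewrite /pol /triangle_polar /dot3 /=; ring.
(* Tangent chords join B-conjugate points. The third point [l] only witnesses that [X m] and [X n]
   are independent. *)
have joined_pol l m n : l \in Os -> m \in Os -> n \in Os ->
    uniq [:: l; m; n] -> tangent_joined Ot v m n -> dot3 (pol m) (X n) = 0.
  move=> lO mO nO lmn [h [t [hO tanh tm tn]]].
  apply: (@dual_conic_conjugate _ a b c a' b' c' _ _ _
    (dot3 t (v i), dot3 t (v j), dot3 t (v k))) => //.
  - exact: SX.
  - exact: SX.
  - exact: (X_cross l).
  - apply: contraNneq (tangent_at_neq0 arcT hO tanh) => -[ti tj tk].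
    by apply: contraNT D_neq0 => t0; rewrite (det3_eq0 t0).
  - exact: (Tabc h).
  - by rewrite dot3_coords tm mulr0.
  - by rewrite dot3_coords tn mulr0.
have pol_neq0 l m n : l \in Os -> m \in Os -> n \in Os ->
    uniq [:: l; m; n] -> pol l != 0.
  move=> lO mO nO /(X_det _ _ _ lO mO nO); apply: contraNneq.
  rewrite /pol /triangle_polar => -[/eqP x0 /eqP y0 /eqP z0].
  move: x0 y0 z0; rewrite !mulf_eq0 -!orbA.
  rewrite (negPf a_n0) (negPf b_n0) (negPf c_n0).
  rewrite (negPf a'_n0) (negPf b'_n0) (negPf c'_n0) /=.
  move=> /eqP x0 /eqP y0 /eqP z0; rewrite /det3 [X l]/coords x0 y0 z0.
  by rewrite /dot3 /= !mul0r !addr0.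
move: p_uniq; rewrite /= !inE !negb_or !andbT.
case/and3P=> /and3P[n01 n02 n03] /andP[n12 n13] n23.
have u012 : uniq [:: p0; p1; p2] by rewrite uniq3E n01 n02 n12.
have u120 : uniq [:: p1; p2; p0] by rewrite -(rot_uniq 2).
have u201 : uniq [:: p2; p0; p1] by rewrite -(rot_uniq 1).
have u102 : uniq [:: p1; p0; p2] by rewrite uniq3E eq_sym n01 n12 n02.
have u130 : uniq [:: p1; p3; p0].
  by rewrite uniq3E n13 eq_sym n01 eq_sym n03.
have u123 : uniq [:: p1; p2; p3] by rewrite uniq3E n12 n13 n23.
have B01 := joined_pol _ _ _ p2O p0O p1O u201 j01.
have B12 := joined_pol _ _ _ p0O p1O p2O u012 j12.
have B03 : dot3 (pol p0) (X p3) = 0.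
  by rewrite polC (joined_pol _ _ _ p1O p3O p0O u130 j30).
(* The polar of [p1] contains [p0] and [p2] and belongs to the dual conic, so it serves as the line
   joining them. *)
have B02 : dot3 (pol p0) (X p2) = 0.
  apply: (@dual_conic_conjugate _ a b c a' b' c' _ _ _ (pol p1)) => //.
  - exact: SX.
  - exact: SX.
  - exact: (X_cross p1).
  - exact: (pol_neq0 p1 p2 p0).
  - exact/dual_conic_triangle_polar/SX.
  - by rewrite polC.
(* The polar of [p0] now contains three points of the arc, a contradiction. *)
have := X_det _ _ _ p1O p2O p3O u123.
by rewrite (det3_eq0 (pol_neq0 p0 p1 p2 p0O p1O p2O u012)) ?eqxx.
Qed.

End Joined.

(** * Transfer to ovals and Poncelet polygons *)

Lemma tangent_joinP (F : finFieldType) (O : {set point F}) (P Q : point F) :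
  tangent_join O P Q -> tangent_joined O (@point_vec F) P Q.
Proof.
case/existsP => L /and3P[]; rewrite !incidentE => /eqP LP /eqP LQ /cards1P[R RE].
exists R, (line_vec L); split=> //.
  by have := set11 R; rewrite -RE inE => /andP[].
by move=> S SO; have := in_set1 S R; rewrite -RE inE SO incidentE.
Qed.

Lemma two_neq0_odd_char (F : finFieldType) (p k : nat) :
  prime p -> odd p -> #|F| = (p ^ k)%N -> (2%:R : F) != 0.
Proof.
move=> p_pr p_odd cardF; apply/eqP => two0.
have /andP[_ /eqP] := card_finPcharP cardF p_pr.
rewrite -(odd_double_half p) p_odd natrD -muln2 natrM two0 mulr0 addr0.
by apply/eqP; rewrite oner_neq0.
Qed.

Close Scope ring_scope.

Theorem theorem4 (p k q : nat) (F : finFieldType) (Ot Os : {set point F}) :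
  prime p -> odd p -> 0 < k -> q = p ^ k -> #|F| = q ->
  oval Ot -> oval Os ->
  (exists T : 3.-tuple (point F), poncelet_polygon Ot Os T) ->
  forall m : nat, 4 <= m <= q.+1 ->
    ~ exists s : m.-tuple (point F), poncelet_polygon Ot Os s.
Proof.
move=> p_pr p_odd _ -> cardF /oval_arc arcT /oval_arc arcS.
have two_neq0 := two_neq0_odd_char p_pr p_odd cardF.
move=> [[[|A [|B [|C [|? ?]]]] //= size_T]].
case/and4P=> _ /= ABC /and4P[AO BO CO _].
move=> /and4P[/tangent_joinP AB /tangent_joinP BC /tangent_joinP CA _].
move=> m /andP[m_ge4 _] [[s size_s]].
case/and4P=> _ /= s_uniq sO s_cycle; rewrite -{m size_s}(eqP size_s) in m_ge4.
case: s m_ge4 s_uniq sO s_cycle => [|P0 [|P1 [|P2 [|P3 s]]]] //= _ s_uniq.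
case/and4P=> P0O P1O P2O sO.
case/and3P=> /tangent_joinP j01 /tangent_joinP j12 /andP[_].
rewrite rcons_path => /andP[_ /tangent_joinP jl0].
have lastO : last P3 s \in Os.
  by apply: (allP (sO : all [in Os] (P3 :: s))); apply: mem_last.
(* Only the first three vertices and the last one matter; as m is at least 4, the last differs from
   the other three, and it is [P3] itself when m = 4. *)
have p_uniq : uniq [:: P0; P1; P2; last P3 s].
  apply: subseq_uniq (s_uniq : uniq [:: P0, P1, P2, P3 & s]).
  apply: (cat_subseq (subseq_refl [:: P0; P1; P2])).
  by rewrite sub1seq mem_last.
exact: (poncelet_triangle_unique two_neq0 arcT arcS AO BO CO ABC AB BC CA
  P0O P1O P2O lastO p_uniq j01 j12 jl0).
Qed.
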